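(* Let $L_1,\ldots,L_n\ge 0$ be random variables and $L=\sum_{i=1}^n L_i$. Suppose there is a random vector $(S_1,\ldots,S_k)$ with the following properties: (i) The variables $L_1,\ldots,L_n$ are independent conditional on realisations of $(S_1,\ldots,S_k)$. (ii) For each $i=1,\ldots,n$ there are probabilities $p_i(s_1,\ldots,s_k)\in[0,1]$ and densities $0\le f_i(\ell,s_1,\ldots,s_k)$ such that the distribution function of $L_i$ conditional on $(S_1,\ldots,S_k)$ is given for $\ell\ge 0$ by $$\mathrm{P}[L_i\le \ell\,|\,(S_1,\ldots,S_k)=(s_1,\ldots,s_k)] = 1-p_i(s_1,\ldots,s_k)+p_i(s_1,\ldots,s_k)\int_0^\ell f_i(x,s_1,\ldots,s_k)\,dx .$$ Define $I_n=\{1,\ldots,n\}$. Then for $\ell\ge 0$ the distribution function of $L$ can be written as $$\mathrm{P}[L\le \ell] = p+(1-p)\int_0^\ell f(x)\,dx,$$ with $$p=\mathrm{P}[L_1=0,\ldots,L_n=0],$$ $$f(x)=\sum_{\emptyset\ne I\subset I_n}\mathrm{E}_{\mathrm{P}}\Big[\prod_{i\in I}p_i(S_1,\ldots,S_k)\prod_{i\in I_n\setminus I}\bigl(1-p_i(S_1,\ldots,S_k)\bigr)\,\Bigl(\bigotimes_{i\in I} f_i(\cdot,S_1,\ldots,S_k)\Bigr)(x)\Big].$$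
   Context: The random variables $L_1,\ldots,L_n$ represent the losses of a financial institution on its exposures to borrowers $i=1,\ldots,n$ within a fixed time period, $L$ is the portfolio-wide loss, and $(S_1,\ldots,S_k)$ are called systematic factors. $\mathrm{P}$ denotes the underlying (real-world) probability measure and $\mathrm{E}_{\mathrm{P}}$ expectation with respect to $\mathrm{P}$. For each value $(s_1,\ldots,s_k)$ of the systematic factors, $f_i(\cdot,s_1,\ldots,s_k)$ is a probability density in its first argument. The symbol $\bigotimes_{i\in I}$ denotes the multiple convolution of the densities $f_i(\cdot,s_1,\ldots,s_k)$, $i\in I$, in the first argument. The sum runs over all nonempty subsets $I$ of $I_n$, including $I=I_n$.
   Formalization: The printed formula counts the factor 1-p twice (it fails for n=1, constant p_1=1/2); here f is the printed sum divided by 1-p (for p=1 the factor is set to 0); the p_i are taken measurable and the f_i jointly measurable. *)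

(* Defs.v *)
From HB Require Import structures.
From mathcomp Require Import all_boot all_order all_algebra.
From mathcomp Require Import all_classical all_reals all_analysis.

Set Implicit Arguments.
Unset Strict Implicit.
Unset Printing Implicit Defensive.

Import Order.TTheory GRing.Theory Num.Theory.
Import numFieldNormedType.Exports.

Local Open Scope classical_set_scope.
Local Open Scope ring_scope.
Local Open Scope ereal_scope.

(* [g] is a version of the conditional probability s |-> P[A | X = s]. *)
Definition is_cond_prob (d d' : measure_display) (T : measurableType d)
    (T' : measurableType d') (R : realType) (P : probability T R)
    (X : {RV P >-> T'}) (A : set T) (g : T' -> R) : Prop :=
  measurable_fun [set: T'] g /\
  forall B : set T', measurable B ->
    P (A `&` X @^-1` B) = \int[distribution P X]_(s in B) (g s)%:E.

(* Versions of conditional probabilities exist (Radon-Nikodym) and are unique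
   almost everywhere, so quantifying over all versions [g] is the same as
   fixing one. Subfamilies are covered by taking some [B i] to be [setT]. *)
Definition cond_independent (d d' : measure_display) (T : measurableType d)
    (T' : measurableType d') (R : realType) (P : probability T R) (n : nat)
    (L : 'I_n -> {RV P >-> R}) (X : {RV P >-> T'}) : Prop :=
  forall (B : 'I_n -> set R) (g : 'I_n -> T' -> R),
    (forall i, measurable (B i)) ->
    (forall i, is_cond_prob X (L i @^-1` B i) (g i)) ->
    is_cond_prob X [set w | forall i, B i (L i w)]
      (fun s => (\prod_(i < n) g i s)%R).

Definition prob_density (R : realType) (f : R -> R) : Prop :=
  [/\ measurable_fun [set: R] f, forall x, (0 <= f x)%R
    & \int[lebesgue_measure]_x (f x)%:E = 1].

(* The convolution of two real-valued densities may be +oo on a null set, so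
   values are kept in [\bar R]. *)
Definition convolution (R : realType) (f g : R -> \bar R) (x : R) : \bar R :=
  \int[lebesgue_measure]_y (f y * g (x - y)%R).

(* The value on [::] is a dummy: the unit of convolution is not a function. *)
Fixpoint convolution_seq (R : realType) (fs : seq (R -> \bar R)) : R -> \bar R :=
  match fs with
  | [::] => fun=> 0
  | [:: f] => f
  | f :: fs' => convolution f (convolution_seq fs')
  end.

(* On nonnegative measurable functions convolution is associative and
   commutative (pointwise, by Tonelli), so the enumeration order is
   irrelevant. *)
Definition multi_convolution (R : realType) (n : nat) (I : {set 'I_n})
    (f : 'I_n -> R -> R) : R -> \bar R :=
  convolution_seq [seq (fun x => (f i x)%:E) | i <- enum I].

(* The expectation is an integral in [\bar R] because the integrand may be
   infinite. The total mass over [0, +oo[ is P[L_i > 0 for some i], not 1, when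
   [p] and [f] describe the conditional laws of losses L_i given S. *)
Definition mixed_convolution (d d' : measure_display) (T : measurableType d)
    (T' : measurableType d') (R : realType) (P : probability T R)
    (S : {RV P >-> T'}) (n : nat) (p : 'I_n -> T' -> R)
    (f : 'I_n -> R -> T' -> R) (x : R) : \bar R :=
  \sum_(I : {set 'I_n} | I != finset.set0)
    \int[P]_w ((\prod_(i in I) p i (S w) *
                \prod_(i in ~: I) (1 - p i (S w)))%:E *
               multi_convolution I (fun i y => f i y (S w)) x).

(* Main.v *)
Require Import Defs.
From HB Require Import structures.
From mathcomp Require Import all_boot all_order all_algebra.
From mathcomp Require Import all_classical all_reals all_analysis.
From mathcomp Require Import measurable_realfun.

Set Implicit Arguments.
Unset Strict Implicit.
Unset Printing Implicit Defensive.

Import Order.TTheory GRing.Theory Num.Theory.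
Import numFieldNormedType.Exports.

Local Open Scope classical_set_scope.
Local Open Scope ring_scope.
Local Open Scope ereal_scope.

(** Split the sample space according to the set [I] of borrowers with a strictly
    positive loss. On the piece indexed by [I] the total loss is the sum of the
    [L_i], [i] in [I], and given [S = s] the vector of these losses has the
    density [\prod_(i in I) p_i(s) f_i(., s)], multiplied by the probability
    [\prod_(i notin I) (1 - p_i(s))] that the others vanish
    ([prob_loss_support_box]). Hence, given [S = s], the total loss restricted to
    this piece has as density the convolution of the [f_i(., s)], weighted by
    [\prod_(i in I) p_i(s) * \prod_(i notin I) (1 - p_i(s))]. The piece
    [I = set0] is the event that all losses are zero and contributes the atom [p0];
    integrating out [S] by Tonelli and summing over the other pieces gives
    [(1 - p0) f0].

    Two points need an argument.

    The hypotheses describe the conditional law of [L_i] only through the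
    intervals [[0, l]], while independence has to be used for arbitrary Borel sets.
    [cond_prob_pos] extends the description to all Borel sets, by uniqueness of
    finite measures agreeing on a pi-system ([image_density_unique]). The densities
    [f_i(., s)] are probability densities on the whole line, so one also has to
    show that they carry no mass on the negative half-line wherever [p_i(s) > 0],
    for almost every [s]; [negative_mass] obtains this from a comparison of total
    masses.

    Conditional independence speaks of boxes, while the event that the sum is at
    most [l] is not a box. [density_of_sum] handles two summands: the weighted
    product density agrees with the law of the pair on rectangles, hence on all
    Borel sets of the plane, in particular on [{(y, z) | y + z in C}], where
    Tonelli and the translation invariance of Lebesgue measure produce the
    convolution. [density_of_sum_seq] iterates this, one summand at a time, keeping
    the constraint on the summand that is removed as part of the conditioning
    event. *)

(** * Recognising a density on a pi-system *)

Section image_density.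
Context dX dY (X : measurableType dX) (Y : measurableType dY) (R : realType).
Variables (mu : {measure set X -> \bar R}) (phi : X -> Y) (h : X -> \bar R).
Hypotheses (mphi : measurable_fun setT phi) (mh : measurable_fun setT h)
  (h0 : forall x, 0 <= h x).

(** The image under [phi] of the measure with density [h] with respect to [mu];
    with [phi] a projection it is the marginal law of one coordinate. *)
Definition image_density (A : set Y) := \int[mu]_(x in phi @^-1` A) h x.

Let image_density0 : image_density set0 = 0.
Proof. by rewrite /image_density preimage_set0 integral_set0. Qed.

Let image_density_ge0 A : 0 <= image_density A.
Proof. exact: integral_ge0. Qed.

Let image_density_sigma_additive : semi_sigma_additive image_density.
Proof.
move=> F mF tF mUF; rewrite /image_density preimage_bigcup.
apply: semi_sigma_additive_nng_induced => //.
- by move=> n; rewrite -[X in measurable X]setTI; exact: mphi.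
- apply/trivIsetP => /= i j _ _ ij; rewrite -preimage_setI.
  by move/trivIsetP : tF => /(_ _ _ _ _ ij) ->//; rewrite preimage_set0.
- by rewrite -preimage_bigcup -[X in measurable X]setTI; exact: mphi.
Qed.

HB.instance Definition _ := isMeasure.Build _ _ _ image_density
  image_density0 image_density_ge0 image_density_sigma_additive.

Definition image_density_measure : {measure set Y -> \bar R} := image_density.

End image_density.

(** Both sides are finite measures in [A], the left one being the law of [Z]
    restricted to the event [D]. Allowing [phi] is what permits [mu] to be a
    product with the law of the systematic factors, which are then integrated
    out. *)
Lemma image_density_unique d dX dY (T : measurableType d) (X : measurableType dX)
    (Y : measurableType dY) (R : realType) (P : probability T R)
    (D : set T) (Z : T -> Y) (mu : {measure set X -> \bar R}) (phi : X -> Y)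
    (h : X -> \bar R) (G : set (set Y)) (g : (set Y)^nat) :
  measurable D -> measurable_fun setT Z -> measurable_fun setT phi ->
  measurable_fun setT h -> (forall x, 0 <= h x) ->
  measurable = <<s G >> -> setI_closed G -> (forall n, G (g n)) ->
  \bigcup_n g n = setT ->
  (forall A, G A -> P (D `&` Z @^-1` A) = \int[mu]_(x in phi @^-1` A) h x) ->
  forall A, measurable A ->
    P (D `&` Z @^-1` A) = \int[mu]_(x in phi @^-1` A) h x.
Proof.
move=> mD mZ mphi mh h0 mG GI Gg gT PE A mA.
pose m1 : {measure set Y -> \bar R} := pushforward (mrestr P mD) Z.
have m1E B : m1 mZ B = P (D `&` Z @^-1` B) by rewrite setIC.
rewrite -m1E -[RHS]/(image_density_measure mu mphi mh h0 A).
apply: (measure_unique G g) => //.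
- by move=> B GB; rewrite m1E PE.
- move=> n; rewrite m1E (le_lt_trans (probability_le1 _ _)) ?ltry//.
  apply: measurableI => //; rewrite -[X in measurable X]setTI; apply: (mZ) => //.
  by rewrite mG; apply: sub_sigma_algebra.
Qed.

Lemma measurable_rays (R : realType) :
  @measurable _ R = <<s [set A | exists x : R, A = `]-oo, x]%classic] >>.
Proof.
apply/seteqP; split.
  rewrite -[X in X `<=` _]/(@measurable _ (measurableTypeR R)) RGenOInfty.measurableE.
  apply: smallest_sub; first exact: smallest_sigma_algebra.
  move=> _ [x ->]; rewrite -setCitvl.
  by apply: sigma_algebraC; apply: sub_sigma_algebra; exists x.
apply: smallest_sub; first exact: sigma_algebra_measurable.
by move=> _ [x ->]; exact: measurable_itv.
Qed.

Lemma rays_cover (R : realType) : \bigcup_n `]-oo, (n%:R : R)]%classic = setT.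
Proof.
apply/seteqP; split => // x _; exists (Num.truncn x).+1 => //=.
by rewrite in_itv/= ltW// truncnS_gt.
Qed.

(** * Weighted Tonelli identities and convolution *)

Lemma lebesgue_measure_shift (R : realType) (y : R) (A : set R) : measurable A ->
  pushforward lebesgue_measure
    (fun z : measurableTypeR R => z + y : measurableTypeR R)%R A =
  lebesgue_measure A.
Proof.
move=> mA; apply/esym/lebesgue_measure_unique => //=.
  exact: measurable_funD.
move=> _ _ [[a b]] _ <-.
rewrite /pushforward /=.
have -> : (fun z : R => z + y)%R @^-1` `]a, b]%classic = `](a - y)%R, (b - y)%R]%classic.
  by apply/seteqP; split => z /=; rewrite !in_itv/= ltrBlDr lerBrDr.
rewrite !lebesgue_measure_itv/= !lte_fin ltrD2r -!EFinB.
by case: ifP => // _; congr EFin; rewrite opprB addrA subrK.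
Qed.

Lemma ge0_integral_shift (R : realType) (y : R) (A : set R) (f : R -> \bar R) :
  measurable A -> measurable_fun setT f -> (forall x, 0 <= f x) ->
  \int[lebesgue_measure]_(x in A) f (x - y)%R =
  \int[lebesgue_measure]_(z in (fun z : R => z + y)%R @^-1` A) f z.
Proof.
move=> mA mf f0.
pose shift (t : R) (z : measurableTypeR R) : measurableTypeR R := (z + t)%R.
have ms t : measurable_fun setT (shift t) by exact: measurable_funD.
have mfs : measurable_fun setT (fun x : R => f (x - y)%R).
  exact: (measurableT_comp mf (ms (- y)%R)).
transitivity (\int[pushforward lebesgue_measure (shift y)]_(x in A) f (x - y)%R).
  by apply: eq_measure_integral => B mB _; exact/esym/lebesgue_measure_shift.
rewrite ge0_integral_pushforward//.
- by apply: eq_integral => z _ /=; rewrite /shift addrK.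
- exact: measurable_funTS.
Qed.

Section weighted_tonelli.
Context d' dX (T' : measurableType d') (X : measurableType dX) (R : realType).
Variables (Q : {sigma_finite_measure set T' -> \bar R})
  (m : {sigma_finite_measure set X -> \bar R}).
Variables (c : T' -> \bar R) (F : X -> T' -> \bar R).
Hypotheses (mc : measurable_fun setT c) (c0 : forall s, 0 <= c s).
Hypotheses (mF : measurable_fun setT (fun z : X * T' => F z.1 z.2))
  (F0 : forall x s, 0 <= F x s).

Let mF_swap : measurable_fun setT (fun z : T' * X => F z.2 z.1).
Proof. exact: (measurableT_comp mF (@measurable_swap _ _ T' X)). Qed.

Lemma measurable_weighted :
  measurable_fun setT (fun z : T' * X => c z.1 * F z.2 z.1).
Proof. by apply: emeasurable_funM => //; exact: measurableT_comp. Qed.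

Lemma measurable_section s : measurable_fun setT (F ^~ s).
Proof. exact: (measurableT_comp mF (pair2_measurable s)). Qed.

Lemma measurable_snd_preimage (A : set X) :
  measurable A -> measurable ((snd : T' * X -> X) @^-1` A).
Proof. by move=> mA; rewrite -[X in measurable X]setTI; exact: measurable_snd. Qed.

Lemma measurable_section_integral (A : set X) : measurable A ->
  measurable_fun setT (fun s => \int[m]_(x in A) F x s).
Proof.
move=> mA.
pose G := (fun z : T' * X => F z.2 z.1) \_ (snd @^-1` A).
have -> : (fun s => \int[m]_(x in A) F x s) = fubini_F m G.
  by apply/funext => s; rewrite [LHS]integral_mkcond.
apply: measurable_fun_fubini_tonelli_F.
- apply/(measurable_restrictT _ _).1; first exact: measurable_snd_preimage.
  exact: measurable_funTS.
- by move=> z; apply: erestrict_ge0 => // ? _.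
Qed.

(** [c] is a weight and [F ^~ s] a density depending on a parameter [s]: the
    mixture of the measures with these densities is an image density. *)
Lemma weighted_tonelli (A : set X) : measurable A ->
  \int[Q \x m]_(z in snd @^-1` A) (c z.1 * F z.2 z.1) =
  \int[Q]_s (c s * \int[m]_(x in A) F x s).
Proof.
move=> mA; rewrite [LHS]integral_mkcond fubini_tonelli1; last 2 first.
- apply/(measurable_restrictT _ _).1; first exact: measurable_snd_preimage.
  exact: measurable_funTS measurable_weighted.
- by move=> z; apply: erestrict_ge0 => // ? _; rewrite mule_ge0.
apply: eq_integral => s _; rewrite /fubini_F -ge0_integralZl//.
  by rewrite [RHS]integral_mkcond.
exact: measurable_funTS (measurable_section s).
Qed.

Lemma weighted_tonelli_swap (A : set X) : measurable A ->
  \int[Q]_s (c s * \int[m]_(x in A) F x s) =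
  \int[m]_(x in A) \int[Q]_s (c s * F x s).
Proof.
move=> mA; rewrite -weighted_tonelli// [LHS]integral_mkcond fubini_tonelli2; last 2 first.
- apply/(measurable_restrictT _ _).1; first exact: measurable_snd_preimage.
  exact: measurable_funTS measurable_weighted.
- by move=> z; apply: erestrict_ge0 => // ? _; rewrite mule_ge0.
rewrite [RHS]integral_mkcond; apply: eq_integral => x _.
transitivity (\int[Q]_s (if x \in A then c s * F x s else 0)).
  exact: eq_integral.
by rewrite patchE; case: ifPn => // _; rewrite integral0.
Qed.

End weighted_tonelli.

Section plane_lebesgue.
Variable R : realType.

(** Giving the product its own name lets it carry a sigma-finite structure, which
    is needed to form its product with the law of the factors. *)
Definition plane_lebesgue := @lebesgue_measure R \x @lebesgue_measure R.

HB.instance Definition _ := Measure.on plane_lebesgue.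

Let plane_lebesgue_sigma_finite : sigma_finite setT plane_lebesgue.
Proof.
pose I (n : nat) : set (measurableTypeR R) := `[(- n%:R)%R, (n%:R)%R]%classic.
have mI n : measurable (I n) by exact: measurable_itv.
exists (fun n => I n `*` I n).
- apply/esym; rewrite -subTset => -[x y] _.
  exists (Num.truncn (Num.max `|x| `|y|)%R).+1 => //.
  have := truncnS_gt (Num.max `|x| `|y|)%R; rewrite gt_max => /andP[xn yn].
  by split; rewrite /I /= in_itv/= -ler_norml ltW.
- move=> n; split; first exact: measurableX.
  rewrite [ltLHS]product_measure1E//= lebesgue_measure_itv/= lte_fin.
  by case: ifP => _; rewrite ?mul0e ?ltry// -EFinD -EFinM ltry.
Qed.

HB.instance Definition _ := Measure_isSigmaFinite.Build _ _ _ plane_lebesgue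
  plane_lebesgue_sigma_finite.

End plane_lebesgue.

Section convolution.
Context d' (T' : measurableType d') (R : realType).
Variables (f g : R -> T' -> \bar R).
Hypotheses (mf : measurable_fun setT (fun z : R * T' => f z.1 z.2))
  (mg : measurable_fun setT (fun z : R * T' => g z.1 z.2)).
Hypotheses (f0 : forall x s, 0 <= f x s) (g0 : forall x s, 0 <= g x s).

Let measurable_integrand :
  measurable_fun setT (fun z : R * (R * T') => f z.1 z.2.2 * g (z.2.1 - z.1)%R z.2.2).
Proof.
apply: emeasurable_funM.
- apply: (measurableT_comp mf (g := fun z : R * (R * T') => (z.1, z.2.2))).
  apply: measurable_fun_pair => //.
  exact: (measurableT_comp (@measurable_snd _ _ R T')).
- apply: (measurableT_comp mg (g := fun z : R * (R * T') => (z.2.1 - z.1, z.2.2)%R)).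
  apply: measurable_fun_pair => //.
    apply: measurable_funB => //.
    exact: (measurableT_comp (@measurable_fst _ _ R T')).
  exact: (measurableT_comp (@measurable_snd _ _ R T')).
Qed.

Lemma measurable_convolution :
  measurable_fun setT (fun z : R * T' => convolution (f ^~ z.2) (g ^~ z.2) z.1).
Proof.
have F0 (y : R) (z : R * T') : 0 <= f y z.2 * g (z.1 - y)%R z.2 by rewrite mule_ge0.
exact: (measurable_section_integral lebesgue_measure measurable_integrand F0 measurableT).
Qed.

(** For fixed [y] the substitution [x = y + z] turns the inner integral over
    [{z | y + z in C}] into one over [C]; exchanging the integrals then leaves the
    convolution inside. *)
Lemma integral_convolution (C : set R) s : measurable C ->
  \int[lebesgue_measure \x lebesgue_measure]_(z in (fun z : R * R => z.1 + z.2)%R @^-1` C)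
    (f z.1 s * g z.2 s) =
  \int[lebesgue_measure]_(x in C) convolution (f ^~ s) (g ^~ s) x.
Proof.
move=> mC.
pose k (z : R * R) := f z.1 s * g z.2 s.
have mD : measurable ((fun z : R * R => z.1 + z.2)%R @^-1` C).
  rewrite -[X in measurable X]setTI; apply: (measurable_funD (D := [set: R * R])
    (f := fst) (g := snd)) => //.
have mfs : measurable_fun setT (f ^~ s) := measurable_section mf s.
have mgs : measurable_fun setT (g ^~ s) := measurable_section mg s.
have mk : measurable_fun setT k.
  by apply: emeasurable_funM; [exact: (measurableT_comp mfs)|exact: (measurableT_comp mgs)].
rewrite [LHS]integral_mkcond fubini_tonelli1; last 2 first.
- by apply/(measurable_restrictT _ _).1 => //; exact: measurable_funTS mk.
- by move=> z; apply: erestrict_ge0 => // ? _; rewrite mule_ge0.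
transitivity (\int[lebesgue_measure]_y
    (f y s * \int[lebesgue_measure]_(x in C) g (x - y)%R s)).
  apply: eq_integral => y _; rewrite (@ge0_integral_shift _ y C (g ^~ s))// -ge0_integralZl//.
  - rewrite /fubini_F [RHS]integral_mkcond; apply: eq_integral => z _.
    rewrite !patchE /=; congr (if _ then _ else _).
    have -> : (fun z : R => z + y)%R = (fun z : R => y + z)%R.
      by apply/funext => t; rewrite addrC.
    by [].
  - rewrite -[X in measurable X]setTI.
    by apply: (measurable_funD (D := [set: R]) (f := id) (g := cst y)) => //.
  - exact: measurable_funTS.
have mg' : measurable_fun setT (fun z : R * R => g (z.1 - z.2)%R s).
  by apply: (measurableT_comp mgs); exact: measurable_funB.
exact: (weighted_tonelli_swap lebesgue_measure lebesgue_measure mfs (f0 ^~ s) mg'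
  (fun x y => g0 (x - y)%R s) mC).
Qed.

Lemma integral_rectangle (A B : set R) s : measurable A -> measurable B ->
  \int[lebesgue_measure \x lebesgue_measure]_(z in A `*` B) (f z.1 s * g z.2 s) =
  \int[lebesgue_measure]_(y in A) f y s * \int[lebesgue_measure]_(z in B) g z s.
Proof.
move=> mA mB.
pose k (z : R * R) := f z.1 s * g z.2 s.
have mfs : measurable_fun setT (f ^~ s) := measurable_section mf s.
have mgs : measurable_fun setT (g ^~ s) := measurable_section mg s.
have mk : measurable_fun setT k.
  by apply: emeasurable_funM; [exact: (measurableT_comp mfs)|exact: (measurableT_comp mgs)].
rewrite [LHS]integral_mkcond fubini_tonelli1; last 2 first.
- apply/(measurable_restrictT _ _).1; first exact: measurableX.
  exact: measurable_funTS mk.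
- by move=> z; apply: erestrict_ge0 => // ? _; rewrite mule_ge0.
rewrite muleC -ge0_integralZl//; last 2 first.
- exact: measurable_funTS.
- exact: integral_ge0.
rewrite [RHS]integral_mkcond; apply: eq_integral => y _.
rewrite /fubini_F patchE; case: ifPn => yA.
- rewrite muleC -ge0_integralZl//; last exact: measurable_funTS.
  rewrite [RHS]integral_mkcond; apply: eq_integral => z _.
  by rewrite !patchE in_setX yA.
- by apply: integral0_eq => z _; rewrite patchE in_setX (negbTE yA).
Qed.

(** The hypothesis says that, on the event [D], the pair [(X, Y)] has the joint
    density [f * g] mixed over [s] with weight [c]; it only mentions rectangles,
    which generate the Borel sets of the plane. The event [D] and the weight [c] are
    there to absorb further variables. *)
Lemma density_of_sum d (T : measurableType d) (P : probability T R)
    (Q : {sigma_finite_measure set T' -> \bar R}) (c : T' -> \bar R)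
    (D : set T) (X Y : T -> R) :
  measurable_fun setT c -> (forall s, 0 <= c s) ->
  measurable D -> measurable_fun setT X -> measurable_fun setT Y ->
  (forall A B, measurable A -> measurable B ->
    P (D `&` (X @^-1` A `&` Y @^-1` B)) =
    \int[Q]_s (c s * (\int[lebesgue_measure]_(y in A) f y s *
                      \int[lebesgue_measure]_(z in B) g z s))) ->
  forall C, measurable C ->
    P (D `&` [set w | C (X w + Y w)%R]) =
    \int[Q]_s (c s * \int[lebesgue_measure]_(x in C) convolution (f ^~ s) (g ^~ s) x).
Proof.
move=> mc c0 mD mX mY PE C mC.
pose k (z : R * R) s := f z.1 s * g z.2 s.
have mk : measurable_fun setT (fun z : (R * R) * T' => k z.1 z.2).
  apply: emeasurable_funM.
  - apply: (measurableT_comp mf (g := fun z : (R * R) * T' => (z.1.1, z.2))).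
    by apply: measurable_fun_pair => //; exact: (measurableT_comp (@measurable_fst _ _ R R)).
  - apply: (measurableT_comp mg (g := fun z : (R * R) * T' => (z.1.2, z.2))).
    by apply: measurable_fun_pair => //; exact: (measurableT_comp (@measurable_snd _ _ R R)).
have k0 z s : 0 <= k z s by rewrite mule_ge0.
have mC' : measurable ((fun z : R * R => z.1 + z.2)%R @^-1` C).
  rewrite -[X in measurable X]setTI; apply: (measurable_funD (D := [set: R * R])
    (f := fst) (g := snd)) => //.
transitivity (\int[Q]_s (c s * \int[lebesgue_measure \x lebesgue_measure]_(z in
    (fun z : R * R => z.1 + z.2)%R @^-1` C) k z s)); last first.
  by apply: eq_integral => s _; rewrite integral_convolution.
rewrite -(weighted_tonelli Q (@plane_lebesgue R) mc c0 mk k0 mC').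
pose rectangles : set (set (R * R)) := [set A `*` B | A in measurable & B in measurable].
apply: (@image_density_unique _ _ _ T _ (R * R)%type R P D (fun w => (X w, Y w))
  (Q \x @plane_lebesgue R) snd (fun z => c z.1 * k z.2 z.1) rectangles (fun=> setT)) => //.
- exact: measurable_fun_pair.
- exact: measurable_weighted mc mk.
- by move=> z; rewrite mule_ge0.
- exact: measurable_prod_measurableType.
- move=> _ _ [A mA [B mB <-]] [A' mA' [B' mB' <-]].
  exists (A `&` A'); first exact: measurableI.
  by exists (B `&` B'); [exact: measurableI|rewrite setXI].
- by move=> _; exists setT => //; exists setT => //; rewrite setXTT.
- by rewrite bigcup_const.
move=> _ [A mA [B mB <-]].
rewrite (weighted_tonelli Q (@plane_lebesgue R) mc c0 mk k0 (measurableX mA mB)).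
rewrite (eq_integral _ _ (fun s _ => congr1 _ (integral_rectangle s mA mB))).
exact: PE.
Qed.

End convolution.

(** * Sums of finitely many variables *)

Section sum_of_variables.
Context d d' (T : measurableType d) (T' : measurableType d') (R : realType)
  (P : probability T R) (Q : {sigma_finite_measure set T' -> \bar R}) (I : eqType).
Variables (X : I -> T -> R) (f : I -> R -> T' -> \bar R).
Hypotheses (mX : forall i, measurable_fun setT (X i))
  (mf : forall i, measurable_fun setT (fun z : R * T' => f i z.1 z.2))
  (f0 : forall i x s, 0 <= f i x s).

Lemma convolution_seq_ge0 (js : seq I) s x :
  0 <= convolution_seq [seq f i ^~ s | i <- js] x.
Proof.
elim: js x => [//|i [|j js] ih] x; first exact: f0.
by apply: integral_ge0 => y _; rewrite mule_ge0.
Qed.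

Lemma measurable_convolution_seq (js : seq I) : measurable_fun setT
  (fun z : R * T' => convolution_seq [seq f i ^~ z.2 | i <- js] z.1).
Proof.
elim: js => [|i [|j js] ih]; first exact: measurable_cst.
  exact: mf.
apply: (measurable_convolution
  (g := fun x s => convolution_seq [seq f k ^~ s | k <- j :: js] x) (mf i) ih) => // x s.
exact: convolution_seq_ge0.
Qed.

(** Induction on [js]. Fixing a Borel set [A] for the first variable and adding
    [X i] in [A] to the event [D], with the factor [\int_A f i] added to the weight
    [c], leaves a family to which the induction hypothesis applies; letting [A] vary
    gives the hypothesis of [density_of_sum]. Hence the quantification over [D] and
    [c] inside the induction. *)
Lemma density_of_sum_seq (js : seq I) : js != [::] -> uniq js ->
  forall (D : set T) (c : T' -> \bar R), measurable D ->
  measurable_fun setT c -> (forall s, 0 <= c s) ->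
  (forall A : I -> set R, (forall i, measurable (A i)) ->
    P (D `&` [set w | forall i, i \in js -> A i (X i w)]) =
    \int[Q]_s (c s * \prod_(i <- js) \int[lebesgue_measure]_(x in A i) f i x s)) ->
  forall C, measurable C ->
    P (D `&` [set w | C (\sum_(i <- js) X i w)%R]) =
    \int[Q]_s (c s * \int[lebesgue_measure]_(x in C)
                       convolution_seq [seq f i ^~ s | i <- js] x).
Proof.
elim: js => [//|i [|j js] ih] _.
  move=> _ D c mD mc c0 PE C mC; have := PE (fun=> C) (fun=> mC).
  rewrite (eq_integral (fun s => c s * \int[lebesgue_measure]_(x in C) f i x s)).
    by move=> <-; congr (P (D `&` _)); apply/seteqP; split => w /=; rewrite big_seq1;
      [move=> Cw k; rewrite inE => /eqP ->|apply; rewrite mem_head].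
  by move=> s _; rewrite big_seq1.
have := ih isT; set t := j :: js => {}ih /= /andP[it ut] D c mD mc c0 PE C mC.
have mXC k A : measurable A -> measurable (X k @^-1` A).
  by move=> mA; rewrite -[X in measurable X]setTI; exact: mX.
have -> : [set w | C (\sum_(k <- i :: t) X k w)%R] =
    [set w | C (X i w + \sum_(k <- t) X k w)%R].
  by apply/seteqP; split => w /=; rewrite big_cons.
apply: (density_of_sum (g := fun x s => convolution_seq [seq f k ^~ s | k <- t] x)) => //.
- exact: measurable_convolution_seq.
- by move=> x s; exact: convolution_seq_ge0.
- by apply: measurable_sum.
move=> A B mA mB.
have mfA : measurable_fun setT (fun s => \int[lebesgue_measure]_(x in A) f i x s).
  exact: (measurable_section_integral lebesgue_measure (mf i) (f0 i) mA).
have cA0 s : 0 <= c s * \int[lebesgue_measure]_(x in A) f i x s.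
  by rewrite mule_ge0// integral_ge0.
rewrite setIA (ih ut _ _ _ (emeasurable_funM mc mfA) cA0 _ B mB).
- by apply: eq_integral => s _; rewrite muleA.
- by apply: measurableI => //; exact: mXC.
move=> A' mA'.
have mA'' k : measurable (if k == i then A else A' k) by case: ifP.
have nki k : k \in t -> (k == i) = false.
  by move=> kt; apply: contraNF it => /eqP <-.
transitivity (P (D `&` [set w | forall k, k \in i :: t ->
    (if k == i then A else A' k) (X k w)])).
  rewrite -setIA; congr (P (D `&` _)); apply/seteqP; split => w /=.
  - move=> [Aw A'w] k; rewrite inE => /orP[/eqP ->|kt]; first by rewrite eqxx.
    by rewrite nki//; exact: A'w.
  - move=> Aw; split; first by have := Aw i; rewrite eqxx mem_head; exact.
    by move=> k kt; have := Aw k; rewrite nki// inE kt orbT; exact.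
rewrite (PE (fun k => if k == i then A else A' k) mA''); apply: eq_integral => s _.
rewrite big_cons eqxx muleA; congr (_ * _).
by rewrite !big_seq; apply: eq_bigr => k kt; rewrite nki.
Qed.

End sum_of_variables.

(** * Conditional law of a single loss *)

Lemma adde_fin_inj (R : realType) (x y z : \bar R) :
  x \is a fin_num -> x + y = x + z -> y = z.
Proof. by move=> xf; rewrite !(addeC x) => /(congr1 (fun t => t - x)); rewrite !addeK. Qed.

Section prob_density_theory.
Context (R : realType) (g : R -> R).
Hypothesis g_density : prob_density g.

Lemma measurable_prob_density : measurable_fun setT (EFin \o g).
Proof. by have [mg _ _] := g_density; apply/measurable_EFinP. Qed.

Lemma integral_prob_density_le1 (A : set R) : measurable A ->
  \int[lebesgue_measure]_(x in A) (g x)%:E <= 1.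
Proof.
have [_ g0 <-] := g_density => mA; apply: ge0_subset_integral => //.
  exact: measurable_prob_density.
by move=> x _; rewrite lee_fin.
Qed.

Lemma Rintegral_prob_density (A : set R) : measurable A ->
  ((\int[lebesgue_measure]_(x in A) g x)%R)%:E =
  \int[lebesgue_measure]_(x in A) (g x)%:E.
Proof.
have [_ g0 _] := g_density => mA; apply: fineK; rewrite ge0_fin_numE.
  exact: le_lt_trans (integral_prob_density_le1 mA) (ltry _).
by apply: integral_ge0 => x _; rewrite lee_fin.
Qed.

End prob_density_theory.

Section conditional_loss.
Context d d' (T : measurableType d) (T' : measurableType d') (R : realType)
  (P : probability T R) (L : {RV P >-> R}) (S : {RV P >-> T'})
  (p : T' -> R) (f : R -> T' -> R).
Hypotheses (L0 : forall w, (0 <= L w)%R)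
  (mp : measurable_fun setT p) (p01 : forall s, (0 <= p s <= 1)%R)
  (mf : measurable_fun setT (fun z : R * T' => f z.1 z.2))
  (f_density : forall s, prob_density (f ^~ s))
  (cdfL : forall l : R, (0 <= l)%R -> is_cond_prob S [set w | (L w <= l)%R]
     (fun s => (1 - p s + p s * \int[lebesgue_measure]_(x in `[0%R, l]) f x s)%R)).

Let Q : {measure set T' -> \bar R} := distribution P S.
Let mass A s := \int[lebesgue_measure]_(x in A) (f x s)%:E.

Let f0 x s : (0 <= f x s)%R. Proof. by have [_ + _] := f_density s; exact. Qed.
Let p0 s : (0 <= p s)%R. Proof. by have /andP[] := p01 s. Qed.
Let q0 s : (0 <= 1 - p s)%R. Proof. by have /andP[] := p01 s; rewrite subr_ge0. Qed.

Let mass_ge0 A s : 0 <= mass A s.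
Proof. by apply: integral_ge0 => x _; rewrite lee_fin. Qed.

Let msection s : measurable_fun setT (fun x => (f x s)%:E).
Proof. exact: measurable_prob_density. Qed.

Let massU A B s : measurable A -> measurable B -> [disjoint A & B] ->
  mass (A `|` B) s = mass A s + mass B s.
Proof.
move=> mA mB AB; apply: ge0_integral_setU => //.
- exact: measurable_funTS (msection s).
- by move=> x _; rewrite lee_fin.
Qed.

Let massT s : mass setT s = 1. Proof. by have [] := f_density s. Qed.

Let mass_measurable A : measurable A -> measurable_fun setT (mass A).
Proof.
apply: (measurable_section_integral lebesgue_measure (F := fun x s => (f x s)%:E)).
- by apply/measurable_EFinP.
- by move=> x s; rewrite lee_fin.
Qed.

Let mpE : measurable_fun setT (EFin \o p). Proof. exact/measurable_EFinP. Qed.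

Let pmass_measurable A : measurable A ->
  measurable_fun setT (fun s => (p s)%:E * mass A s).
Proof. by move=> mA; apply: emeasurable_funM => //; exact: mass_measurable. Qed.

Let pmass_ge0 A s : 0 <= (p s)%:E * mass A s.
Proof. by rewrite mule_ge0// lee_fin. Qed.

Let mLA (A : set R) : measurable A -> measurable (L @^-1` A).
Proof. by move=> mA; rewrite -[X in measurable X]setTI; exact: measurable_funP. Qed.

Let mSB (B : set T') : measurable B -> measurable (S @^-1` B).
Proof. by move=> mB; rewrite -[X in measurable X]setTI; exact: measurable_funP. Qed.

(** This is the case [l = 0] of the conditional distribution function. *)
Lemma cond_prob_zero : is_cond_prob S (L @^-1` [set 0%R]) (fun s => 1 - p s)%R.
Proof.
have [_ cdf0] := cdfL (lexx 0%R); split; first exact: measurable_funB.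
move=> B mB; have -> : L @^-1` [set 0%R] = [set w | (L w <= 0)%R].
  apply/seteqP; split => w /=; first by move=> ->.
  by move=> Lw; apply/eqP; rewrite eq_le Lw L0.
rewrite cdf0//; apply: eq_integral => s _.
by rewrite set_itv1 Rintegral_set1 mulr0 addr0.
Qed.

Let mpos : measurable [set w | (0 < L w)%R].
Proof.
rewrite (_ : [set w | _] = L @^-1` `]0%R, +oo[); first exact: mLA.
by apply/seteqP; split => w /=; rewrite in_itv/= andbT.
Qed.

(** Subtract the case [l = 0] from the general one; the common term is finite. *)
Let prob_pos_le B l : measurable B -> (0 <= l)%R ->
  P (S @^-1` B `&` [set w | (0 < L w)%R] `&` [set w | (L w <= l)%R]) =
  \int[Q]_(s in B) ((p s)%:E * mass `[0%R, l] s).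
Proof.
move=> mB l0.
have m0 : measurable (L @^-1` [set 0%R] `&` S @^-1` B).
  by apply: measurableI; [exact: mLA|exact: mSB].
have [_ /(_ B mB) cdf_l] := cdfL l0; have [_ /(_ B mB) P0] := cond_prob_zero.
apply: (@adde_fin_inj _ (P (L @^-1` [set 0%R] `&` S @^-1` B))).
  by rewrite fin_num_measure.
rewrite -measureU//; last 2 first.
- apply: measurableI; last exact: (mLA (measurable_itv `]-oo, l])).
  by apply: measurableI; [exact: mSB|exact: mpos].
- by apply/seteqP; split => // w [[/= Lw _] [[_ /=]]]; rewrite Lw ltxx.
rewrite P0 -[RHS]ge0_integralD//; last 3 first.
- by move=> s _; rewrite lee_fin.
- by apply/measurable_EFinP; apply: measurable_funTS; exact: measurable_funB.
- exact: measurable_funTS (pmass_measurable _).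
have -> : L @^-1` [set 0%R] `&` S @^-1` B `|`
    S @^-1` B `&` [set w | (0 < L w)%R] `&` [set w | (L w <= l)%R] =
    [set w | (L w <= l)%R] `&` S @^-1` B.
  apply/seteqP; split => w /=.
  - by move=> [[Lw Bw]|[[Bw _] Lw]]; split => //; rewrite Lw.
  - move=> [Lw Bw]; have := L0 w; rewrite le_eqVlt => /orP[/eqP Lw0|Lw0]; first by left.
    by right.
apply: (etrans cdf_l); apply: eq_integral => s _.
by rewrite EFinD EFinM (Rintegral_prob_density (f_density s)).
Qed.

(** Truncating [f] to the nonnegative half-line makes both sides vanish on the
    rays [`]-oo, x]] with [x < 0], so that the rays with [0 <= x], where
    [prob_pos_le] applies, decide everything. *)
Let prob_pos_trunc B A : measurable B -> measurable A ->
  P (S @^-1` B `&` [set w | (0 < L w)%R] `&` L @^-1` A) =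
  \int[Q]_(s in B) ((p s)%:E * mass (A `&` `[0%R, +oo[) s).
Proof.
move=> mB mA.
pose c := (EFin \o p) \_ B.
pose F (x : R) s := ((fun x => (f x s)%:E) \_ `[0%R, +oo[) x.
have mc : measurable_fun setT c.
  by apply/(measurable_restrictT _ _).1 => //; exact: measurable_funTS.
have c0 s : 0 <= c s by apply: erestrict_ge0 => t _; rewrite lee_fin.
have F0 x s : 0 <= F x s by apply: erestrict_ge0 => t _; rewrite lee_fin.
have mF : measurable_fun setT (fun z : R * T' => F z.1 z.2).
  have -> : (fun z : R * T' => F z.1 z.2) =
      (fun z => (f z.1 z.2)%:E) \_ (fst @^-1` `[0%R, +oo[) by [].
  apply/(measurable_restrictT _ _).1.
    by rewrite -[X in measurable X]setTI; exact: measurable_fst.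
  by apply: measurable_funTS; exact/measurable_EFinP.
have trunc B' : measurable B' -> \int[Q]_s (c s * \int[lebesgue_measure]_(x in B') F x s) =
    \int[Q]_(s in B) ((p s)%:E * mass (B' `&` `[0%R, +oo[) s).
  move=> mB'; rewrite [RHS]integral_mkcond; apply: eq_integral => s _.
  rewrite /c !patchE; case: ifPn => // _; last by rewrite mul0e.
  by rewrite /mass integral_mkcondr.
rewrite -trunc//.
rewrite -(weighted_tonelli (distribution P S) lebesgue_measure mc c0 mF F0 mA).
apply: (@image_density_unique _ _ _ T _ R R P _ L (distribution P S \x lebesgue_measure)
  snd (fun z => c z.1 * F z.2 z.1) [set A | exists x : R, A = `]-oo, x]%classic]
  (fun n => `]-oo, n%:R]%classic)) => //.
- by apply: measurableI => //; exact: mSB.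
- exact: measurable_weighted mc mF.
- by move=> z; rewrite mule_ge0.
- exact: measurable_rays.
- move=> _ _ [x ->] [y ->]; exists (Num.min x y).
  apply/seteqP; split => z /=; rewrite !in_itv/= le_min; first by move=> [-> ->].
  by move=> /andP[-> ->].
- by move=> n; exists n%:R.
- exact: rays_cover.
move=> _ [x ->].
rewrite (weighted_tonelli (distribution P S) lebesgue_measure mc c0 mF F0 (measurable_itv _)).
rewrite trunc//; have [x0|x0] := leP 0%R x.
- rewrite (_ : `]-oo, x] `&` `[0%R, +oo[ = `[0%R, x]%classic); last first.
    apply/seteqP; split => z /=; rewrite !in_itv/= ?andbT; first by move=> [-> ->].
    by move=> /andP[-> ->].
  exact: prob_pos_le.
- rewrite (_ : _ `&` `[0%R, +oo[ = set0); last first.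
    apply/seteqP; split => z //=; rewrite !in_itv/= andbT => -[zx z0].
    by have := le_lt_trans (le_trans z0 zx) x0; rewrite ltxx.
  have -> : S @^-1` B `&` [set w | (0 < L w)%R] `&` L @^-1` `]-oo, x] = set0.
    apply/seteqP; split => w //=; rewrite !in_itv/= => -[[_ Lw] Lx].
    by have := lt_trans (lt_le_trans Lw Lx) x0; rewrite ltxx.
  rewrite measure0; apply/esym/integral0_eq => s _.
  by rewrite /mass integral_set0 mule0.
Qed.

Let mass_split A s : measurable A ->
  mass A s = mass (A `&` `[0%R, +oo[) s + mass (A `&` `]-oo, 0%R[) s.
Proof.
move=> mA; rewrite -massU//.
- rewrite -setIUr (_ : _ `|` _ = setT) ?setIT//.
  by apply/seteqP; split => // x _ /=; rewrite !in_itv/= andbT; case: leP => _; [left|right].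
- exact: measurableI.
- exact: measurableI.
- apply/eqP/seteqP; split => // x [[_ /=] + [_ /=]].
  by rewrite !in_itv/= andbT => x0 /(le_lt_trans x0); rewrite ltxx.
Qed.

(** The masses of [p f] over the half-line and over the whole line coincide after
    integration over [s]: the former is [P (0 < L)] by [prob_pos_trunc], the latter
    is [\int p = 1 - P (L = 0)] because [f ^~ s] integrates to one. *)
Let negative_mass : \int[Q]_s ((p s)%:E * mass `]-oo, 0%R[ s) = 0.
Proof.
have Ppos : P [set w | (0 < L w)%R] = \int[Q]_s ((p s)%:E * mass `[0%R, +oo[ s).
  have := prob_pos_trunc measurableT measurableT.
  by rewrite !preimage_setT !setTI setIT.
have : P (L @^-1` [set 0%R]) + P [set w | (0 < L w)%R] = 1.
  rewrite -measureU//; last first.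
    by apply/seteqP; split => // w [/= ->]; rewrite ltxx.
  rewrite -(@probability_setT _ _ _ P); congr (P _).
  apply/seteqP; split => // w _ /=; have := L0 w.
  by rewrite le_eqVlt => /orP[/eqP Lw0|Lw0]; [left|right].
have [_ /(_ _ measurableT)] := cond_prob_zero.
rewrite preimage_setT setIT => P0.
have : \int[Q]_s (1 - p s)%:E + \int[Q]_s (p s)%:E = 1.
  rewrite -ge0_integralD//; last 3 first.
  - by move=> s _; rewrite lee_fin.
  - by apply/measurable_EFinP; exact: measurable_funB.
  - by move=> s _; rewrite lee_fin.
  under eq_integral => s _ do rewrite -EFinD subrK.
  by rewrite integral_cst// mul1e; exact: (probability_setT (distribution P S)).
move=> <-; rewrite -P0 => /adde_fin_inj; rewrite fin_num_measure; last exact: mLA.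
move=> /(_ isT) Pp.
have : \int[Q]_s ((p s)%:E * mass `[0%R, +oo[ s) + \int[Q]_s ((p s)%:E * mass `]-oo, 0%R[ s)
    = \int[Q]_s ((p s)%:E * mass `[0%R, +oo[ s) + 0.
  rewrite -ge0_integralD//; last 2 first.
  - exact: pmass_measurable.
  - exact: pmass_measurable.
  rewrite adde0 -Ppos Pp; apply: eq_integral => s _.
  rewrite -(ge0_muleDr _ (mass_ge0 _ s) (mass_ge0 _ s)).
  by have := mass_split s measurableT; rewrite massT !setTI => <-; rewrite mule1.
apply: adde_fin_inj; rewrite -Ppos fin_num_measure//.
Qed.

(** The truncation can be dropped because the part of [f] over the negative
    half-line is negligible for the weight [p]. *)
Lemma cond_prob_pos (A : set R) : measurable A ->
  is_cond_prob S (L @^-1` (A `&` [set x : R | (0 < x)%R]))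
    (fun s => p s * \int[lebesgue_measure]_(x in A) f x s)%R.
Proof.
move=> mA; split.
  apply: measurable_funM => //; apply: measurableT_comp => //.
  exact: mass_measurable.
move=> B mB.
transitivity (P (S @^-1` B `&` [set w | (0 < L w)%R] `&` L @^-1` A)).
  by congr (P _); rewrite preimage_setI setIC -setIA [X in _ `&` X]setIC.
rewrite prob_pos_trunc// -[LHS]adde0.
have mA0 : measurable (A `&` `[0%R, +oo[) by exact: measurableI.
have mA1 : measurable (A `&` `]-oo, 0%R[) by exact: measurableI.
have <- : \int[Q]_(s in B) ((p s)%:E * mass (A `&` `]-oo, 0%R[) s) = 0.
  apply/eqP; rewrite eq_le integral_ge0// andbT -negative_mass.
  apply: (@le_trans _ _ (\int[Q]_s ((p s)%:E * mass (A `&` `]-oo, 0%R[) s))).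
    by apply: ge0_subset_integral => //; exact: pmass_measurable.
  apply: ge0_le_integral => //; [exact: pmass_measurable|exact: pmass_measurable|].
  move=> s _; apply: lee_wpmul2l; first by rewrite lee_fin.
  apply: ge0_subset_integral => //.
  - exact: measurable_funTS (msection s).
  - by move=> x _; rewrite lee_fin.
rewrite -ge0_integralD//; last 2 first.
- exact: measurable_funTS (pmass_measurable _).
- exact: measurable_funTS (pmass_measurable _).
apply: eq_integral => s _; rewrite EFinM (Rintegral_prob_density (f_density s))//.
rewrite -/(mass A s) (mass_split s mA).
by apply/esym/ge0_muleDr; exact: mass_ge0.
Qed.

End conditional_loss.

(** * Decomposition of the portfolio loss *)

Section portfolio.
Context d d' (T : measurableType d) (T' : measurableType d') (R : realType)
  (P : probability T R) (n : nat)
  (L : 'I_n -> {RV P >-> R}) (S : {RV P >-> T'})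
  (p : 'I_n -> T' -> R) (f : 'I_n -> R -> T' -> R).
Hypotheses (L0 : forall i w, (0 <= L i w)%R) (indL : cond_independent L S)
  (mp : forall i, measurable_fun setT (p i))
  (p01 : forall i s, (0 <= p i s <= 1)%R)
  (mf : forall i, measurable_fun setT (fun z : R * T' => f i z.1 z.2))
  (f_density : forall i s, prob_density (f i ^~ s))
  (cdfL : forall i (l : R), (0 <= l)%R ->
     is_cond_prob S [set w | (L i w <= l)%R]
       (fun s => (1 - p i s +
          p i s * \int[lebesgue_measure]_(x in `[0%R, l]) f i x s)%R)).

Let Q : {sigma_finite_measure set T' -> \bar R} := distribution P S.

Definition loss_support (I : {set 'I_n}) : set T :=
  [set w | forall i, (i \in I) = (0 < L i w)%R].

(** Given [S = s], the probability that the positive losses are those in [I]. *)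
Definition support_prob (I : {set 'I_n}) (s : T') : R :=
  (\prod_(i in I) p i s * \prod_(i in ~: I) (1 - p i s))%R.

Let mL i : measurable_fun setT (L i).
Proof. exact: measurable_funP. Qed.

Let fE i x s := (f i x s)%:E.
Let fE0 i x s : 0 <= fE i x s.
Proof. by have [_ f0 _] := f_density i s; rewrite lee_fin. Qed.
Let mfE i : measurable_fun setT (fun z : R * T' => fE i z.1 z.2).
Proof. exact/measurable_EFinP. Qed.

Lemma support_prob_ge0 I s : (0 <= support_prob I s)%R.
Proof.
by rewrite mulr_ge0// prodr_ge0// => i _; have /andP[] := p01 i s; rewrite ?subr_ge0.
Qed.

Lemma measurable_support_prob I : measurable_fun setT (support_prob I).
Proof.
apply: measurable_funM.
- under eq_fun do rewrite -big_enum.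
  by apply: measurable_prod => i _; exact: mp.
- under eq_fun do rewrite -big_enum.
  by apply: measurable_prod => i _; exact: measurable_funB.
Qed.

Lemma measurable_loss_support I : measurable (loss_support I).
Proof.
have -> : loss_support I = \bigcap_i (L i @^-1` [set x : R | (i \in I) = (0 < x)%R]).
  by apply/seteqP; split => w Iw i; [move=> _; exact: Iw|by apply: Iw].
apply: fin_bigcap_measurable => // i _.
rewrite -[X in measurable X]setTI; apply: measurable_funP => //.
case: (i \in I).
- rewrite (_ : [set _ | _] = `]0%R, +oo[%classic); first exact: measurable_itv.
  by apply/seteqP; split => x /=; rewrite in_itv/= andbT; case: (0 < x)%R.
- rewrite (_ : [set _ | _] = `]-oo, 0%R]%classic); first exact: measurable_itv.
  by apply/seteqP; split => x /=; rewrite in_itv/= leNgt; case: (0 < x)%R.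
Qed.

(** Conditional independence applied to the box whose sides are [{0}] outside [I]
    and the positive part of [A i] for [i] in [I]. *)
Lemma prob_loss_support_box I (A : 'I_n -> set R) : (forall i, measurable (A i)) ->
  P (loss_support I `&` [set w | forall i, i \in enum I -> A i (L i w)]) =
  \int[Q]_s ((support_prob I s)%:E *
    \prod_(i <- enum I) \int[lebesgue_measure]_(x in A i) (f i x s)%:E).
Proof.
move=> mA.
pose B i := if i \in I then A i `&` [set x : R | (0 < x)%R] else [set 0%R].
pose g i s := if i \in I then (p i s * \int[lebesgue_measure]_(x in A i) f i x s)%R
              else (1 - p i s)%R.
have mB i : measurable (B i).
  rewrite /B; case: ifP => _ //; apply: measurableI => //.
  rewrite (_ : [set _ | _] = `]0%R, +oo[%classic); first exact: measurable_itv.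
  by apply/seteqP; split => x /=; rewrite in_itv/= andbT.
have gP i : is_cond_prob S (L i @^-1` B i) (g i).
  rewrite /B /g; case: ifP => iI.
  - exact: (cond_prob_pos (L0 i) (mp i) (p01 i) (mf i) (f_density i) (cdfL i) (mA i)).
  - exact: (cond_prob_zero (L0 i) (mp i) (cdfL i)).
have [_ /(_ setT measurableT)] := indL mB gP.
rewrite preimage_setT setIT => PB.
transitivity (P [set w | forall i, B i (L i w)]).
  congr (P _); apply/seteqP; split => w /=.
  - move=> [Iw Aw] i; have := Iw i; rewrite /B; case: ifPn => iI Lw.
    + by split; [apply: Aw; rewrite mem_enum|rewrite /= -Lw].
    + by apply/eqP; rewrite eq_le L0 leNgt -Lw.
  - move=> Bw; split => i; have := Bw i; rewrite /B; last first.
      by rewrite mem_enum => + iI; rewrite iI => -[].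
    by case: ifPn => iI => [[_ ->]|->]; rewrite ?ltxx.
apply: (etrans PB); apply: eq_integral => s _.
rewrite big_enum /support_prob.
transitivity ((\prod_(i in I) p i s *
    (\prod_(i in I) \int[lebesgue_measure]_(x in A i) f i x s) *
    \prod_(i in ~: I) (1 - p i s))%R%:E).
  congr EFin; rewrite (bigID (mem I)) -big_split; congr (_ * _)%R.
  - by apply: eq_bigr => i; rewrite /= /g => ->.
  - by apply: eq_big => [i|i]; rewrite /= ?inE// /g => /negbTE ->.
rewrite mulrAC EFinM -prodEFin; congr (_ * _).
by apply: eq_bigr => i _; rewrite (Rintegral_prob_density (f_density i s)).
Qed.

Let conv (I : {set 'I_n}) x s := convolution_seq [seq fE i ^~ s | i <- enum I] x.

Let conv_ge0 I x s : 0 <= conv I x s.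
Proof. exact: convolution_seq_ge0. Qed.

Let mconv I : measurable_fun setT (fun z : R * T' => conv I z.1 z.2).
Proof. exact: measurable_convolution_seq. Qed.

Let msupport_probE I : measurable_fun setT (EFin \o support_prob I).
Proof. by apply/measurable_EFinP; exact: measurable_support_prob. Qed.

Let support_probE_ge0 I s : 0 <= (support_prob I s)%:E.
Proof. by rewrite lee_fin support_prob_ge0. Qed.

Let support_density (I : {set 'I_n}) x := \int[P]_w ((support_prob I (S w))%:E *
  multi_convolution I (fun i y => f i y (S w)) x).

Let support_densityE I x : support_density I x = \int[Q]_s ((support_prob I s)%:E * conv I x s).
Proof.
rewrite [RHS]ge0_integral_distribution//.
  apply: emeasurable_funM; first exact: msupport_probE.
  exact: (measurableT_comp (mconv I) (pair1_measurable x)).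
by move=> s; rewrite mule_ge0.
Qed.

Lemma support_density_ge0 I x : 0 <= support_density I x.
Proof. by rewrite support_densityE; apply: integral_ge0 => s _; rewrite mule_ge0. Qed.

Lemma measurable_support_density I : measurable_fun setT (support_density I).
Proof.
have -> : support_density I = (fun x => \int[Q]_s ((support_prob I s)%:E * conv I x s)).
  by apply/funext => x; exact: support_densityE.
apply: (measurable_section_integral Q (F := fun s x => (support_prob I s)%:E * conv I x s)) => //.
  exact: (measurable_weighted (msupport_probE I) (mconv I)).
by move=> s x; rewrite mule_ge0.
Qed.

Let sum_support I w : loss_support I w ->
  (\sum_(i <- enum I) L i w = \sum_(i < n) L i w)%R.
Proof.
move=> Iw; rewrite big_enum [RHS](bigID (mem I))/= [X in (_ + X)%R]big1 ?addr0// => i.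
by rewrite Iw => Li; apply/eqP; rewrite eq_le L0 leNgt Li.
Qed.

Lemma prob_loss_support_sum_le I (l : R) : I != finset.set0 ->
  P (loss_support I `&` [set w | (\sum_(i < n) L i w <= l)%R]) =
  \int[lebesgue_measure]_(x in `[0%R, l]) support_density I x.
Proof.
move=> I0.
have mC : measurable (`[0%R, l]%classic : set R) by exact: measurable_itv.
transitivity (P (loss_support I `&`
    [set w | `[0%R, l]%classic (\sum_(i <- enum I) L i w)%R])).
  congr (P _); apply/seteqP; split => w /= [Iw Lw]; split => //.
  - by rewrite in_itv/= sumr_ge0 ?sum_support.
  - by move: Lw; rewrite in_itv/= sum_support// => /andP[].
have enum_neq0 : enum I != [::] by rewrite -size_eq0 -cardE cards_eq0.
rewrite (density_of_sum_seq (Q := Q) mL mfE fE0 enum_neq0 (enum_uniq _)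
  (measurable_loss_support I) (msupport_probE I) (support_probE_ge0 I) _ mC); last first.
  by move=> A mA; exact: prob_loss_support_box.
rewrite (weighted_tonelli_swap Q lebesgue_measure (msupport_probE I)
  (support_probE_ge0 I) (mconv I) (conv_ge0 I) mC).
by apply: eq_integral => x _; rewrite support_densityE.
Qed.

Lemma measurable_sum_le (l : R) : measurable [set w | (\sum_(i < n) L i w <= l)%R].
Proof.
have ms : measurable_fun setT (fun w => \sum_(i < n) L i w)%R by exact: measurable_sum.
by rewrite -[X in measurable X]setTI; exact: (ms measurableT _ (measurable_itv `]-oo, l])).
Qed.

Lemma loss_support0 : loss_support finset.set0 = [set w | forall i, L i w = 0%R].
Proof.
apply/seteqP; split => w /= Lw i.
- by apply/eqP; rewrite eq_le L0 leNgt -Lw inE.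
- by rewrite Lw inE ltxx.
Qed.

(** The events [loss_support I] partition the sample space, and [I = set0] is the
    only one on which the total loss is not described by a density. *)
Lemma prob_sum_le (l : R) : (0 <= l)%R ->
  P [set w | (\sum_(i < n) L i w <= l)%R] = P [set w | forall i, L i w = 0%R] +
    \int[lebesgue_measure]_(x in `[0%R, l]) mixed_convolution S p f x.
Proof.
move=> l0; pose E I := loss_support I `&` [set w | (\sum_(i < n) L i w <= l)%R].
have mE I : measurable (E I).
  apply: measurableI; first exact: measurable_loss_support.
  exact: measurable_sum_le.
have -> : [set w | (\sum_(i < n) L i w <= l)%R] =
    \bigcup_(I in [set` index_enum {set 'I_n}]) E I.
  apply/seteqP; split => [w /= Lw|w [I _ []//]].
  exists [set i | (0 < L i w)%R]%SET; first by rewrite /= mem_index_enum.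
  by split => // i; rewrite inE.
rewrite measure_fin_bigcup//; last first.
  move=> I J _ _ [w [[Iw _] [Jw _]]]; by apply/setP => i; rewrite Iw Jw.
rewrite -fsbig_seq ?index_enum_uniq// (bigD1 finset.set0)//=; congr (_ + _).
  rewrite /E loss_support0; congr (P _); apply/seteqP; split => w /=; first by case.
  by move=> Lw; rewrite big1.
transitivity (\sum_(I : {set 'I_n} | I != finset.set0)
    \int[lebesgue_measure]_(x in `[0%R, l]) support_density I x).
  by apply: eq_bigr => I I0; exact: prob_loss_support_sum_le.
rewrite -big_filter -ge0_integral_sum//.
- by apply: eq_integral => x _; rewrite big_filter.
- by move=> I; apply: measurable_funTS; exact: measurable_support_density.
- by move=> I x _; exact: support_density_ge0.
Qed.

Lemma measurable_mixed_convolution : measurable_fun setT (mixed_convolution S p f).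
Proof.
have -> : mixed_convolution S p f = (fun x =>
    \sum_(I <- [seq J <- index_enum {set 'I_n} | J != finset.set0]) support_density I x).
  by apply/funext => x; rewrite big_filter.
by apply: emeasurable_sum => I; exact: measurable_support_density.
Qed.

Lemma mixed_convolution_ge0 x : 0 <= mixed_convolution S p f x.
Proof. by apply: sume_ge0 => I _; exact: support_density_ge0. Qed.

End portfolio.

Theorem theorem3p3 (R : realType) (d : measure_display) (T : measurableType d)
    (P : probability T R) (n k : nat)
    (L : 'I_n -> {RV P >-> R}) (S : {RV P >-> k.-tuple R})
    (p : 'I_n -> k.-tuple R -> R) (f : 'I_n -> R -> k.-tuple R -> R) :
  (forall i w, (0 <= L i w)%R) ->
  cond_independent L S ->
  (forall i, measurable_fun [set: k.-tuple R] (p i)) ->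
  (forall i s, (0 <= p i s <= 1)%R) ->
  (forall i, measurable_fun [set: R * k.-tuple R] (fun z => f i z.1 z.2)) ->
  (forall i s, prob_density (f i ^~ s)) ->
  (forall i (l : R), (0 <= l)%R ->
     is_cond_prob S [set w | (L i w <= l)%R]
       (fun s => (1 - p i s +
          p i s * \int[lebesgue_measure]_(x in `[0%R, l]) f i x s)%R)) ->
  let p0 : R := fine (P [set w | forall i, L i w = 0%R]) in
  let f0 : R -> \bar R :=
    fun x => ((1 - p0)^-1)%:E * mixed_convolution S p f x in
  forall l : R, (0 <= l)%R ->
    P [set w | (\sum_(i < n) L i w <= l)%R] =
      p0%:E + (1 - p0)%:E * \int[lebesgue_measure]_(x in `[0%R, l]) f0 x.
Proof.
move=> L0 indL mp p01 mf f_density cdfL p0 f0 l l0.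
have main := prob_sum_le L0 indL mp p01 mf f_density cdfL l0.
have mg := measurable_mixed_convolution S mp p01 mf f_density.
have g0 := mixed_convolution_ge0 S mp p01 mf f_density.
have m0 : measurable [set w | forall i, L i w = 0%R].
  by rewrite -(loss_support0 L0); exact: measurable_loss_support.
have p0E : p0%:E = P [set w | forall i, L i w = 0%R].
  by apply: fineK; rewrite fin_num_measure.
have p0_le1 : (p0 <= 1)%R by rewrite -lee_fin p0E probability_le1.
(* For p0 = 1 the normalising factor is 0^-1 = 0, and both sides are equal to 1,
   as the event on the left contains an event of probability p0. *)
have [p0_eq1|p0_neq1] := eqVneq p0 1%R.
  rewrite p0_eq1 subrr mul0e adde0; apply/eqP; rewrite eq_le.
  apply/andP; split; first by exact: probability_le1 (measurable_sum_le L l).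
  rewrite main -p0E p0_eq1 leeDl//; exact: integral_ge0.
have q0 : (0 < 1 - p0)%R by rewrite subr_gt0 lt_neqAle p0_neq1.
rewrite main -p0E; congr (_ + _).
rewrite /f0 ge0_integralZl_EFin//; last 2 first.
- exact: measurable_funTS.
- by rewrite invr_ge0 ltW.
by rewrite muleA -EFinM divff ?mul1e// gt_eqF.
Qed.
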